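(* Let $L,n,k$ be positive integers with $2k<n$, fixed. Then, as $q\to\infty$ over prime powers, there exists an $[n,k,L]_q$-AS family of size at least $(1-o(1))\,q^{\,n-2k-\frac{(n-k)(k+1)}{L+1}}$. Consequently $p^{AS}(n,k,L)\ge n-2k-\frac{(n-k)(k+1)}{L+1}$.
   Context: An $[n,k,L]_q$-almost sparse (AS) family is a family $\mathcal F$ of $k$-dimensional linear subspaces of $\mathbb F_q^n$ ($2k<n$) such that (1) distinct members intersect only in $\{0\}$ and (2) every $(k+1)$-dimensional linear subspace of $\mathbb F_q^n$ intersects nontrivially (i.e. in more than $\{0\}$) at most $L$ members of $\mathcal F$. $m^{AS}_q(n,k,L)$ is the maximum size of such a family and $p^{AS}(n,k,L)=\limsup_{q\to\infty}\log_q m^{AS}_q(n,k,L)$. *)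

(* Defs.v *)
From mathcomp Require Import all_boot all_order all_algebra all_field.
From mathcomp Require Import all_classical all_reals all_analysis.
Set Implicit Arguments. Unset Strict Implicit. Unset Printing Implicit Defensive.
Import Order.TTheory GRing.Theory Num.Theory.
Local Open Scope ring_scope.

Definition is_AS_family (F : finFieldType) (n k L : nat)
    (fam : seq {vspace 'rV[F]_n}) : Prop :=
  [/\ uniq fam,
      (forall U, U \in fam -> \dim U = k),
      (forall U V, U \in fam -> V \in fam -> U != V -> (U :&: V)%VS = 0%VS)
    & (forall W : {vspace 'rV[F]_n}, \dim W = k.+1 ->
        (count (fun U => (U :&: W)%VS != 0%VS) fam <= L)%N)].

Definition AS_exponent (R : realType) (n k L : nat) : R :=
  n%:R - 2 * k%:R - (n%:R - k%:R) * (k%:R + 1) / (L%:R + 1).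
Arguments is_AS_family {F} n k L fam.

(* Main.v *)
Require Import Defs.
From mathcomp Require Import all_boot all_order all_algebra all_field.
From mathcomp Require Import all_classical all_reals all_analysis.
From mathcomp Require Import zify ring lra.
Import Order.TTheory GRing.Theory Num.Theory.
Local Open Scope ring_scope.

(** A random family of about [q^e] row spaces of [k x n] matrices is expected
to work; the choice is made greedily by the method of conditional expectations.
For [t > 0], weight each [(k+1) x n] matrix [B] by [(1 + t)^c], where [c] counts
the members chosen so far that meet the row space of [B]. At every step at least
half of all [k x n] matrices have full rank and a row space independent of each
earlier one, and a proportion of at most [2 q^(2k-n)] of all matrices meets a
given [B]; so some admissible choice multiplies the total weight by at most
[1 + 4 t q^(2k-n)]. With [t = q^(n-2k) / (4 M)], after [M] steps the total weight
is at most [e * q^(n(k+1))] (here [e] is Euler's number). A [(k+1)]-space met by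
more than [L] members has at least [q^((k+1)^2) / 2] bases, each contributing
more than [t^(L+1)], which is too much once [q] is large. No constant factor is
lost: the slack is a factor [q^(k+1)]. *)

(** * Exponential weights and greedy selection *)

Section Potential.
Context {R : realFieldType} {T X : finType}.
Variables (h : X -> pred T) (t : R).

(** [h x a] reads: the candidate [a] hits the point [x]. Divided by the number of points, this is an
    exponential moment of the number of hits. *)
Definition potential (s : seq T) : R := \sum_x (1 + t) ^+ count (h x) s.

Lemma potential_nil : potential [::] = #|X|%:R.
Proof. by rewrite /potential sumr_const. Qed.

Lemma potential_cons a s : potential (a :: s) =
  potential s + t * \sum_x (h x a)%:R * (1 + t) ^+ count (h x) s.
Proof.
rewrite /potential mulr_sumr -big_split /=; apply: eq_bigr => x _.
case: (h x a); rewrite ?mul0r ?mulr0 ?addr0 ?add0n //.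
by rewrite add1n exprS mul1r mulrDl mul1r.
Qed.

Lemma potential_ge (c l : nat) (s : seq T) : 0 <= t ->
  (c <= #|[pred x | (l <= count (h x) s)%N]|)%N ->
  c%:R * (1 + t) ^+ l <= potential s.
Proof.
move=> t0 cl; have t1 : 1 <= 1 + t by rewrite lerDl.
rewrite /potential (bigID [pred x | (l <= count (h x) s)%N]) /=.
apply: ler_wpDr; first by apply: sumr_ge0 => x _; rewrite exprn_ge0 ?addr_ge0.
apply: (@le_trans _ _ (\sum_(x | (l <= count (h x) s)%N) (1 + t) ^+ l)).
  rewrite sumr_const -[leRHS]mulr_natl ler_wpM2r ?exprn_ge0 ?addr_ge0 //.
  by rewrite ler_nat.
by apply: ler_sum => x lx; rewrite ler_weXn2l.
Qed.

Lemma exists_le_mean (g : pred T) (f : T -> R) (c : R) : (0 < #|g|)%N ->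
  \sum_(a | g a) f a <= #|g|%:R * c -> exists2 a, g a & f a <= c.
Proof.
move=> g0 fc; have [/existsP[a /andP[ga fa]]|] := boolP [exists a, g a && (f a <= c)].
  by exists a.
rewrite negb_exists => /forallP cf.
have /card_gt0P[a0 ga0] := g0.
suff : #|g|%:R * c < \sum_(a | g a) f a by rewrite ltNge fc.
rewrite mulr_natl -sumr_const; apply: ltr_sum.
  by apply/hasP; exists a0; rewrite ?mem_index_enum.
by move=> a ga; have := cf a; rewrite (ga : g a) /= -ltNge.
Qed.

(** Averaging over [g]: after exchanging the sums, the weight of each point is counted at most [H]
    times in the increment, and at least [G] candidates share the total. *)
Lemma potential_step (g : pred T) (G H : nat) (s : seq T) : 0 <= t ->
  (0 < G <= #|g|)%N -> (forall x, (#|h x| <= H)%N) ->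
  exists2 a, g a & potential (a :: s) <= potential s * (1 + t * H%:R / G%:R).
Proof.
move=> t0 /andP[G0 Gg] hH; apply: exists_le_mean; first exact: leq_trans Gg.
under eq_bigr do rewrite potential_cons.
have p0 x : 0 <= (1 + t) ^+ count (h x) s by rewrite exprn_ge0 ?addr_ge0.
have P0 : 0 <= potential s by apply: sumr_ge0.
rewrite big_split /= sumr_const -[_ *+ #|_|]mulr_natl mulrDr mulr1 mulrDr lerD2l.
apply: (@le_trans _ _ (t * (H%:R * potential s))).
  rewrite -mulr_sumr ler_wpM2l // exchange_big /= mulr_sumr.
  apply: ler_sum => x _; rewrite -mulr_suml ler_wpM2r //.
  rewrite -natr_sum ler_nat; apply: leq_trans (hH x).
  rewrite -sum1_card [leqRHS]big_mkcond /= [leqLHS]big_mkcond /=.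
  by apply: leq_sum => a _; rewrite unfold_in; case: (g a); case: (h x a).
have -> : t * (H%:R * potential s) = G%:R * (potential s * (t * H%:R / G%:R)).
  by field; rewrite pnatr_eq0 -lt0n.
by rewrite ler_wpM2r ?ler_nat // !mulr_ge0 ?invr_ge0.
Qed.

(** [z] marks candidates excluded outright, [r b] those in conflict with an earlier choice [b]. The
    budget leaves at least [G] candidates at every step. New elements go to the front, hence the
    order in [r b a]. *)
Lemma greedy_sequence (r : rel T) (z : pred T) (D G H Z M : nat) : 0 <= t ->
  (0 < G)%N -> (Z + M * D + G <= #|T|)%N -> (#|z| <= Z)%N ->
  (forall a, (#|r a| <= D)%N) -> (forall x, (#|h x| <= H)%N) ->
  exists s, [/\ size s = M, all (predC z) s, pairwise (fun a b => ~~ r b a) s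
    & potential s <= #|X|%:R * (1 + t * H%:R / G%:R) ^+ M].
Proof.
move=> t0 G0 + zZ rD hH.
elim: M => [|M IH] GT; first by exists [::]; rewrite potential_nil mulr1.
have [|s [sM zs rs Ps]] := IH; first by apply: leq_trans GT; rewrite mulSn; lia.
pose g : pred T := fun a => ~~ (z a || has (r^~ a) s).
have c0 : 0 <= 1 + t * H%:R / G%:R by rewrite addr_ge0 ?mulr_ge0 ?invr_ge0.
have gG : (0 < G <= #|g|)%N.
  rewrite G0 /=.
  have hs : (#|[pred a | has (r^~ a) s]| <= size s * D)%N.
    elim: (s) => [|b s' IHs] /=; first by rewrite eq_card0.
    rewrite mulSn (leq_trans _ (leq_add (rD b) IHs)) // -cardUI.
    apply: (leq_trans _ (leq_addr _ _)); apply: subset_leq_card.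
    by apply/fintype.subsetP => a; rewrite !inE.
  have bad : (#|predC g| <= Z + M * D)%N.
    rewrite -sM; apply: leq_trans (leq_add zZ hs); rewrite -cardUI.
    apply: (leq_trans _ (leq_addr _ _)); apply: subset_leq_card.
    by apply/fintype.subsetP => a; rewrite !inE /g negbK.
  by rewrite -(leq_add2r #|predC g|) cardC; apply: leq_trans GT; rewrite mulSn; lia.
have [a ga Pa] := potential_step g G H s t0 gG hH.
move: ga; rewrite /g negb_or => /andP[za ras].
exists (a :: s); split => /=; first by rewrite sM.
- by rewrite za.
- by rewrite rs andbT all_predC.
- by apply: le_trans Pa _; rewrite exprSr mulrA ler_wpM2r.
Qed.

End Potential.

(** * Row spaces of matrices and how many meet a given one *)

Section RowSpaces.
Context {F : finFieldType} {n : nat}.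

(** The condition is [x != 0], not [x *m A != 0], so a rank-deficient [A] meets every [B]. For [B]
    without rows this is exactly rank deficiency, and one count serves both purposes. *)
Definition meets {d k} (B : 'M[F]_(d, n)) (A : 'M[F]_(k, n)) : bool :=
  [exists x : 'rV_k, (x != 0) && (x *m A <= B)%MS].

(** Where [x] has a nonzero entry [j], row [j] of [A] is recovered from [x *m A] and the other [k]
    rows; [x *m A] is given by [d] coefficients over [B]. *)
Lemma card_mul_row_sub d k (B : 'M[F]_(d, n)) (x : 'rV[F]_k.+1) : x != 0 ->
  (#|[pred A : 'M[F]_(k.+1, n) | (x *m A <= B)%MS]| <= #|F| ^ (d + k * n))%N.
Proof.
move=> /rV0Pn[j xj].
pose f (A : 'M[F]_(k.+1, n)) : 'rV[F]_d * 'M[F]_(k, n) :=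
  (x *m A *m pinvmx B, row' j A).
have -> : (#|F| ^ (d + k * n) = #|{: 'rV[F]_d * 'M[F]_(k, n)}|)%N.
  by rewrite card_prod !card_mx mul1n expnD.
apply: (leq_card_in f) => A A'; rewrite !inE => AB A'B [].
move=> /(congr1 (mulmx^~ B)); rewrite !mulmxKpV // => xA rowA.
apply/eqP; rewrite -subr_eq0; set C := A - A'.
have C0 i : i != j -> row i C = 0.
  rewrite eq_sym => ij; have [i' -> _] := unlift_some ij.
  by apply/rowP => l; move/matrixP/(_ i' l): rowA; rewrite !mxE => ->; rewrite subrr.
have xC : x *m C = 0 by rewrite mulmxBr xA subrr.
move: xC; rewrite mulmx_sum_row (bigD1 j) //= big1 ?addr0; last first.
  by move=> i ij; rewrite C0 ?scaler0.
move/eqP; rewrite scaler_eq0 (negbTE xj) /= => /eqP Cj.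
apply/eqP/row_matrixP => i; rewrite row0.
by have [->|/C0] := eqVneq i j.
Qed.

(* The vectors [x] witnessing [meets B A] come in lines through the origin;
   this saves a factor [#|F| - 1] over the plain union bound. *)
Lemma card_meets d k (B : 'M[F]_(d, n)) :
  (#|[pred A : 'M[F]_(k.+1, n) | meets B A]| <= 2 * #|F| ^ (k + d + k * n))%N.
Proof.
have q1 : (1 < #|F|)%N := finRing_gt1 F.
pose N := #|[pred A : 'M[F]_(k.+1, n) | meets B A]|.
suff : (N * (#|F|).-1 <= #|F| ^ k.+1 * #|F| ^ (d + k * n))%N.
  rewrite -expnD (_ : k.+1 + (d + k * n) = (k + d + k * n).+1)%N; last by lia.
  by rewrite expnS /N; nia.
apply: (@leq_trans (\sum_(A : 'M[F]_(k.+1, n))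
    \sum_(x : 'rV[F]_k.+1 | x != 0%R) (x *m A <= B)%MS)%N).
  rewrite /N -sum1_card big_distrl /= [leqLHS]big_mkcond /=.
  apply: leq_sum => A _; rewrite unfold_in /=.
  case: ifP => // /existsP[x /andP[x0 xA]]; rewrite mul1n.
  have -> : (#|F|.-1 = #|[pred c : F | c != 0%R]|)%N by rewrite -(cardC1 (0 : F)).
  have -> : (\sum_(y : 'rV[F]_k.+1 | y != 0%R) (y *m A <= B)%MS
      = #|[pred y : 'rV[F]_k.+1 | (y != 0%R) && (y *m A <= B)%MS]|)%N.
    rewrite -sum1_card [RHS]big_mkcond [LHS]big_mkcond /=.
    by apply: eq_bigr => y _; rewrite unfold_in /=; case: (y != 0); case: (_ <= _)%MS.
  rewrite -(card_in_imset (f := fun c : F => c *: x)); last first.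
    move=> c c' _ _ /eqP; rewrite -subr_eq0 -scalerBl scaler_eq0 (negbTE x0).
    by rewrite orbF subr_eq0 => /eqP.
  apply: subset_leq_card; apply/fintype.subsetP => _ /imsetP[c c0 ->].
  rewrite !inE in c0 *; rewrite scaler_eq0 negb_or c0 x0 /=.
  by rewrite -scalemxAl scalemx_sub.
rewrite exchange_big /=.
apply: (@leq_trans (\sum_(x : 'rV[F]_k.+1) #|F| ^ (d + k * n))%N); last first.
  by rewrite sum_nat_const card_mx mul1n.
rewrite [leqLHS]big_mkcond /=; apply: leq_sum => x _; case: ifP => // x0.
apply: leq_trans (card_mul_row_sub d k B x x0); rewrite -sum1_card.
by rewrite [leqRHS]big_mkcond /=; apply: leq_sum => A _; rewrite unfold_in.
Qed.

Lemma meets0 k (A : 'M[F]_(k, n)) : ~~ meets (0 : 'M[F]_(0, n)) A -> row_free A.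
Proof.
move=> mA; apply: inj_row_free => v vA; apply/eqP; apply: contraNT mA => v0.
by apply/existsP; exists v; rewrite v0 vA sub0mx.
Qed.

Definition rowspace {k} (A : 'M[F]_(k, n)) : {vspace 'rV[F]_n} :=
  limg (linfun (mulmxr A)).

Lemma mem_rowspaceP k (A : 'M[F]_(k, n)) v :
  reflect (exists x : 'rV_k, v = x *m A) (v \in rowspace A).
Proof.
apply: (iffP memv_imgP) => [[x _ ->]|[x ->]].
  by exists x; rewrite lfunE.
by exists x; rewrite ?memvf ?lfunE.
Qed.

Lemma dim_rowspace k (A : 'M[F]_(k, n)) : row_free A -> \dim (rowspace A) = k.
Proof.
move=> /row_free_inj Ainj; rewrite limg_dim_eq ?dimvf ?dim_matrix ?mul1r //.
rewrite (_ : lker _ = 0%VS) ?capv0 //.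
by apply/eqP/lker0P => x y; rewrite !lfunE /= => /Ainj.
Qed.

Lemma rowspace_vbasis (W : {vspace 'rV[F]_n}) :
  rowspace (\matrix_(i < \dim W) (vbasis W)`_i) = W.
Proof.
apply/vspaceP => v; apply/mem_rowspaceP/idP => [[x ->]|vW].
  rewrite mulmx_sum_row memv_suml // => i _; rewrite rowK memvZ //.
  by rewrite vbasis_mem ?mem_nth ?size_tuple.
exists (\row_i coord (vbasis W) i v); rewrite {1}(coord_vbasis vW).
by rewrite mulmx_sum_row; apply: eq_bigr => i _; rewrite rowK mxE.
Qed.

Lemma exists_basis_mx (d : nat) (W : {vspace 'rV[F]_n}) : \dim W = d ->
  exists2 B : 'M[F]_(d, n), row_free B & rowspace B = W.
Proof.
move=> <-; exists (\matrix_(i < \dim W) (vbasis W)`_i); last exact: rowspace_vbasis.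
apply: inj_row_free => v; rewrite mulmx_sum_row.
under eq_bigr do rewrite rowK.
move=> v0; apply/rowP => i; rewrite mxE.
exact: (freeP (basis_free (vbasisP W)) (fun i => v 0 i)).
Qed.

Lemma rowspace_capN0 d k (B : 'M[F]_(d, n)) (A : 'M[F]_(k, n)) :
  (rowspace A :&: rowspace B)%VS != 0%VS -> meets B A.
Proof.
rewrite -vpick0; have := memv_pick (rowspace A :&: rowspace B)%VS.
set v := vpick _; rewrite memv_cap.
move=> /andP[/mem_rowspaceP[x vx] /mem_rowspaceP[y vy]] v0.
apply/existsP; exists x; rewrite -vx vy submxMl andbT.
by apply: contraNneq v0 => x0; rewrite vx x0 mul0mx.
Qed.

Lemma meets_mull d k (P : 'M[F]_d) (B : 'M[F]_(d, n)) (A : 'M[F]_(k, n)) :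
  P \in unitmx -> meets (P *m B) A = meets B A.
Proof.
move=> Pu; apply: eq_existsb => x.
by rewrite (eqmxMfull B) // row_full_unit.
Qed.

End RowSpaces.

(** * Invertible matrices and the passage to subspaces *)

(** Singular matrices are counted by [card_meets] with [d = 0]: a proportion of at most [2 / #|F|],
    hence at most half. *)
Lemma card_unitmx_ge {F : finFieldType} m : (4 <= #|F|)%N ->
  (#|F| ^ (m.+1 * m.+1) <= 2 * #|[pred P : 'M[F]_m.+1 | P \in unitmx]|)%N.
Proof.
move=> q4; have := card_meets 0 m (0 : 'M[F]_(0, m.+1)).
have : (#|{: 'M[F]_m.+1}| <= #|[pred A : 'M[F]_m.+1 | meets (0 : 'M[F]_(0, m.+1)) A]|
    + #|[pred P : 'M[F]_m.+1 | P \in unitmx]|)%N.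
  rewrite -cardUI (leq_trans _ (leq_addr _ _)) //.
  apply: subset_leq_card; apply/fintype.subsetP => A _; rewrite !inE.
  by rewrite -row_free_unit; case: (boolP (meets _ A)) => //= /meets0.
rewrite card_mx (_ : m.+1 * m.+1 = (m + 0 + m * m.+1).+1)%N; last by lia.
have arith q E a u :
    (3 < q -> q * E <= a + u -> a <= 2 * E -> q * E <= 2 * u)%N by nia.
by rewrite expnS; exact: arith q4.
Qed.

(** The first inequality gives room for [M] greedy choices; by the second, a [k.+2]-dimensional
    space met more than [L] times would exceed the final weight. *)
Lemma AS_family_exists (R : realFieldType) (F : finFieldType) (n k L M G : nat)
    (t : R) :
  0 <= t -> (0 < G)%N ->
  (2 * #|F| ^ (k + k * n) + M * (2 * #|F| ^ (k + k.+1 + k * n)) + G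
     <= #|F| ^ (k.+1 * n))%N ->
  (#|F| ^ (k.+2 * n))%:R
      * (1 + t * (2 * #|F| ^ (k + k.+2 + k * n))%:R / G%:R) ^+ M
    < #|[pred P : 'M[F]_k.+2 | P \in unitmx]|%:R * (1 + t) ^+ L.+1 ->
  exists2 fam : seq {vspace 'rV[F]_n}, is_AS_family n k.+1 L fam & size fam = M.
Proof.
move=> t0 G0 GT ineq.
pose T := 'M[F]_(k.+1, n); pose X := 'M[F]_(k.+2, n).
have [|||| s [sM zs rs Ps]] := @greedy_sequence R T X
  (fun B => [pred A : T | meets B A]) t
  (fun B A : T => meets B A) (fun A : T => meets (0 : 'M[F]_(0, n)) A)
  (2 * #|F| ^ (k + k.+1 + k * n)) G (2 * #|F| ^ (k + k.+2 + k * n))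
  (2 * #|F| ^ (k + k * n)) M t0 G0.
- by rewrite card_mx; exact: GT.
- by have := card_meets 0 k (0 : 'M[F]_(0, n)); rewrite addn0.
- by move=> A; exact: card_meets.
- by move=> B; exact: card_meets.
have dimU U : U \in map rowspace s -> \dim U = k.+1.
  move=> /mapP[A As ->]; apply: dim_rowspace; apply: meets0.
  exact: (allP zs).
have disj : pairwise (fun U V => (U :&: V)%VS == 0%VS) (map rowspace s).
  rewrite pairwise_map; apply: sub_pairwise rs => A A' /=.
  by rewrite /relpre; apply: contraNT => /rowspace_capN0.
exists (map rowspace s); last by rewrite size_map.
split => //.
(* A repeated member would intersect itself trivially, against its positive dimension. *)
- rewrite uniq_pairwise; move: disj.
  apply: (sub_in_pairwise (P := mem (map rowspace s))); last exact/allP.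
  move=> U V /dimU Uk _ /= UV; apply: contraTneq UV => <-.
  by rewrite capvv -dimv_eq0 Uk.
- move=> U V Us Vs UV; move: disj Us Vs UV.
  elim: (map _ s) => // Y l IH /= /andP[/allP Yl {}/IH IH].
  rewrite !inE => /predU1P[->|Ul] /predU1P[->|Vl]; rewrite ?eqxx //.
  + by move=> _; apply/eqP/Yl.
  + by move=> _; rewrite capvC; apply/eqP/Yl.
  + exact: IH.
move=> W /exists_basis_mx[B Bfree <-]; rewrite leqNgt; apply/negP => cL.
move: ineq; rewrite ltNge => /negP; apply.
rewrite -(card_mx F k.+2 n); apply: le_trans Ps; apply: potential_ge => //.
(* All bases [P *m B] of the bad subspace are distinct points, each hit more than [L] times. *)
have injB : injective (fun P : 'M[F]_k.+2 => P *m B) by exact: row_free_inj.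
rewrite -(card_imset _ injB); apply: subset_leq_card.
apply/fintype.subsetP => _ /imsetP[P Pu ->]; rewrite inE in Pu.
rewrite inE; apply: (leq_trans cL); rewrite count_map.
apply: sub_count => A /= /rowspace_capN0.
by rewrite meets_mull.
Qed.

(** Serves negative exponents, where one member is enough. *)
Lemma AS_family_singleton (F : finFieldType) (n k L : nat) :
  (0 < L)%N -> (0 < k <= n)%N ->
  exists2 fam : seq {vspace 'rV[F]_n}, is_AS_family n k L fam & size fam = 1%N.
Proof.
move=> L0 /andP[k0 kn]; pose U := rowspace (pid_mx k : 'M[F]_(k, n)).
exists [:: U] => //; split => //.
- move=> V; rewrite inE => /eqP->; apply: dim_rowspace.
  by rewrite /row_free rank_pid_mx.
- by move=> V W; rewrite !inE => /eqP-> /eqP->; rewrite eqxx.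
- by move=> W _ /=; case: (_ != _); rewrite addn0.
Qed.

(** * Choice of parameters and growth in the field size *)

Lemma expr1Dinv_le_expR1 (R : realType) (M : nat) :
  (1 + M.+1%:R^-1) ^+ M.+1 <= expR (1 : R).
Proof.
have -> : expR 1 = expR (M.+1%:R^-1 : R) ^+ M.+1.
  by rewrite -expRM_natl mulfV // pnatr_eq0.
by rewrite lerXn2r ?nnegrE ?expR_ge0 ?addr_ge0 ?invr_ge0 // expR_ge1Dx.
Qed.

Lemma AS_exponentE (R : realType) (n k L : nat) : (2 * k < n)%N ->
  AS_exponent R n k L = (n - 2 * k)%:R - ((n - k) * k.+1)%:R / L.+1%:R.
Proof.
move=> kn; rewrite /AS_exponent natrB ?(ltnW kn) // !natrM natrB; last by lia.
by rewrite -!natr1.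
Qed.

(* The hypotheses reflect [y = q^e] and [w = q^(e' / (L+1))], where
   [e = n - 2(k+1) - e' / (L+1)] is the exponent for dimension [k+1]. *)
Lemma AS_family_of_size (R : realType) (F : finFieldType) (n k L M : nat)
    (y w : R) :
  (2 * k.+1 < n)%N -> (16 <= #|F|)%N ->
  expR 1 * 2 * 8 ^+ L.+1 < #|F|%:R :> R ->
  1 <= w -> y * w = #|F|%:R ^+ (n - 2 * k.+1) ->
  w ^+ L.+1 = #|F|%:R ^+ ((n - k.+1) * k.+2) ->
  M.+1%:R <= 2 * y ->
  exists2 fam : seq {vspace 'rV[F]_n},
    is_AS_family n k.+1 L fam & size fam = M.+1.
Proof.
move=> kn q16 qL w1 yw wL My.
set a := (n - 2 * k.+1)%N in yw.
pose q := #|F|; pose x : R := q%:R.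
have x0 : 0 < x by rewrite ltr0n /q; apply: leq_trans q16.
have x1 : 1 <= x by rewrite ler1n /q; apply: leq_trans q16.
have y0 : 0 < y.
  by rewrite -(pmulr_rgt0 y (x := 2)) //; apply: lt_le_trans My.
have w0 : 0 < w by apply: lt_le_trans w1.
have Mq : (M.+1 <= 2 * q ^ a)%N.
  rewrite -(ler_nat R) natrM natrX -yw; apply: le_trans My _.
  by rewrite ler_pM2l // ler_peMr // ltW.
(* The unit of comparison: a [q]-th of all [k.+1] by [n] matrices. *)
pose E := (q ^ (k.+1 * n).-1)%N.
have qE : (q ^ (k.+1 * n) = q * E)%N.
  by rewrite -expnS prednK // muln_gt0; lia.
pose Z := (2 * q ^ (k + k * n))%N.
pose D := (2 * q ^ (k + k.+1 + k * n))%N.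
have ZE : (Z <= 2 * E)%N.
  by rewrite leq_mul2l /E leq_pexp2l //=; [rewrite /q | rewrite mulSn]; lia.
have DE : (M.+1 * D <= 4 * E)%N.
  have -> : (4 * E = 2 * q ^ a * D)%N.
    rewrite /E /D mulnACA -expnD; congr (_ * q ^ _)%N.
    by rewrite mulSn /a; lia.
  by rewrite leq_mul2r Mq orbT.
(* At most [6 * E] candidates are ever lost, so [16 <= q] keeps at least half. *)
pose G := (q * E - (Z + M.+1 * D))%N.
have E0 : (0 < E)%N by rewrite expn_gt0 /q; lia.
have qE16 : (16 * E <= q * E)%N by rewrite leq_mul2r q16 orbT.
have G2 : (q * E <= 2 * G)%N by rewrite /G; lia.
have G0 : (0 < G)%N by rewrite /G; lia.
(* Chosen so that each of the [M.+1] steps multiplies the weight by at most [1 + M.+1%:R^-1], in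
   total by at most [expR 1]. *)
pose t : R := x ^+ a / (4 * M.+1%:R).
have M0 : 0 < M.+1%:R :> R by [].
have tw : w / 8 <= t.
  rewrite /t -yw ler_pdivlMr ?mulr_gt0 //.
  have : w * M.+1%:R <= w * (2 * y) by rewrite ler_pM2l.
  by lra.
have t0 : 0 <= t by apply: le_trans tw; lra.
apply: (@AS_family_exists R F n k L M.+1 G t t0 G0).
  by rewrite -/q qE -/Z -/D /G; lia.
rewrite -/q.
have tH : t * (2 * q ^ (k + k.+2 + k * n))%:R / G%:R <= M.+1%:R^-1.
  have -> : t * (2 * q ^ (k + k.+2 + k * n))%:R = (q * E)%:R / 2 / M.+1%:R.
    rewrite -qE natrM !natrX -/x.
    have -> : (k.+1 * n = a + (k + k.+2 + k * n))%N by rewrite mulSn /a; lia.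
    by rewrite (exprD x a) /t; field; rewrite lt0r_neq0.
  rewrite mulrAC ler_piMl ?invr_ge0 ?(ltW M0) //.
  have NG : (q * E)%:R <= 2 * G%:R :> R by rewrite -natrM ler_nat.
  by rewrite ler_pdivrMr ?ltr0n // mul1r; lra.
have tH0 : 0 <= t * (2 * q ^ (k + k.+2 + k * n))%:R / G%:R.
  by apply: divr_ge0 => //; exact: mulr_ge0.
apply: (@le_lt_trans _ _ (x ^+ (k.+2 * n) * expR 1)).
  rewrite natrX ler_wpM2l ?exprn_ge0 ?(ltW x0) //.
  apply: le_trans (expr1Dinv_le_expR1 R M).
  by rewrite lerXn2r ?nnegrE ?addr_ge0 ?invr_ge0 ?lerD2l.
apply: (@lt_le_trans _ _ (x ^+ (k.+2 * k.+2) / 2 * (w / 8) ^+ L.+1)); last first.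
  apply: ler_pM.
  - by rewrite divr_ge0 ?exprn_ge0 ?(ltW x0).
  - by rewrite exprn_ge0 ?divr_ge0 ?(ltW w0).
  - rewrite ler_pdivrMr // -natrX -natrM ler_nat mulnC.
    by apply: card_unitmx_ge; apply: leq_trans q16.
  - rewrite lerXn2r ?nnegrE ?divr_ge0 ?addr_ge0 ?(ltW w0) //.
    by apply: le_trans tw _; rewrite lerDr.
rewrite expr_div_n wL -/q -/x.
have -> : x ^+ (k.+2 * k.+2) / 2 * (x ^+ ((n - k.+1) * k.+2) / 8 ^+ L.+1)
    = x ^+ (k.+2 * n) * (x ^+ k.+2 / (2 * 8 ^+ L.+1)).
  have -> : x ^+ (k.+2 * n) * (x ^+ k.+2 / (2 * 8 ^+ L.+1)) =
      x ^+ (k.+2 * n + k.+2) / (2 * 8 ^+ L.+1) by rewrite exprD mulrA.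
  (* The slack [x ^+ k.+2] appears here; one factor [x] of it absorbs the constants through [qL]. *)
  have -> : (k.+2 * n + k.+2 = k.+2 * k.+2 + (n - k.+1) * k.+2)%N by nia.
  by rewrite exprD; field; rewrite expf_neq0.
rewrite ltr_pM2l ?exprn_gt0 // ltr_pdivlMr ?mulr_gt0 ?exprn_gt0 //.
rewrite mulrA; apply: (lt_le_trans qL).
by rewrite -/q -/x exprS ler_peMr ?(ltW x0) // exprn_ege1.
Qed.

Lemma AS_family_large (R : realType) (n k L : nat) :
  (0 < L)%N -> (0 < k)%N -> (2 * k < n)%N ->
  exists Q : nat, forall F : finFieldType, (Q <= #|F|)%N ->
    exists2 fam : seq {vspace 'rV[F]_n}, is_AS_family n k L fam &
      (#|F|%:R : R) `^ AS_exponent R n k L <= (size fam)%:R.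
Proof.
case: k => // k L0 _ kn.
exists (16 + (Num.trunc (expR (1 : R) * 2 * 8 ^+ L.+1)).+1)%N => F QF.
have q16 : (16 <= #|F|)%N by apply: leq_trans QF; rewrite leq_addr.
have x1 : 1 <= #|F|%:R :> R by rewrite ler1n; apply: leq_trans q16.
have x0 : 0 < #|F|%:R :> R by apply: lt_le_trans x1.
set x : R := #|F|%:R in x0 x1 *; set e := AS_exponent _ _ _ _.
have [e0|e0] := ltP e 0.
  have [|fam famP fam1] := @AS_family_singleton F n k.+1 L L0; first by lia.
  by exists fam; rewrite // fam1 -(powRr0 x) ler_powR // ltW.
pose y := x `^ e; pose c : R := ((n - k.+1) * k.+2)%:R / L.+1%:R.
have y1 : 1 <= y by rewrite -(powRr0 x) ler_powR.
have c0 : 0 <= c by rewrite divr_ge0.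
(* The size is [(Num.trunc y).+1], which exceeds [y] and is at most [2 * y] because [1 <= y]. *)
have [|||||fam famP famM] :=
  @AS_family_of_size R F n k L (Num.trunc y) y (x `^ c) kn q16.
- apply: lt_le_trans (truncnS_gt _) _; rewrite ler_nat.
  by apply: leq_trans QF; rewrite leq_addl.
- by rewrite -(powRr0 x) ler_powR.
- rewrite -/x -powR_mulrn ?(ltW x0) // /y -powRD; last by rewrite (gt_eqF x0) implybT.
  by rewrite /e AS_exponentE // subrK.
- rewrite -/x -!powR_mulrn ?powR_ge0 ?(ltW x0) // -powRrM.
  by rewrite mulfVK // pnatr_eq0.
- rewrite -natr1.
  have : (Num.trunc y)%:R <= y by rewrite truncn_le (le_trans _ y1).
  by lra.
by exists fam; rewrite // famM ltW // truncnS_gt.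
Qed.

Theorem mainTheorem9 (R : realType) (n k L : nat) :
  (0 < L)%N -> (0 < k)%N -> (0 < n)%N -> (2 * k < n)%N ->
  (* (1 - o(1)) q^e lower bound as q -> oo over (sizes of) finite fields *)
  (forall eps : R, 0 < eps ->
     exists Q : nat, forall F : finFieldType, (Q <= #|F|)%N ->
       exists fam : seq {vspace 'rV[F]_n},
         is_AS_family n k L fam /\
         (1 - eps) * ((#|F|%:R : R) `^ AS_exponent R n k L) <= (size fam)%:R)
  /\
  (* consequently p^AS(n,k,L) = limsup_q log_q m^AS_q(n,k,L) >= e *)
  (forall eps : R, 0 < eps -> forall Q : nat,
     exists F : finFieldType, (Q <= #|F|)%N /\
       exists fam : seq {vspace 'rV[F]_n},
         is_AS_family n k L fam /\
         (#|F|%:R : R) `^ (AS_exponent R n k L - eps) <= (size fam)%:R).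
Proof.
move=> L0 k0 _ kn; have [Q0 famQ] := AS_family_large R n k L L0 k0 kn.
split=> eps eps0.
  exists Q0 => F /famQ[fam famP le_fam]; exists fam; split => //.
  apply: le_trans le_fam; rewrite ler_piMl ?powR_ge0 //.
  by rewrite lerBlDr lerDl ltW.
(* Prime fields supply arbitrarily large field sizes for the limsup. *)
move=> Q; have [p Qp p_pr] := prime_above (maxn Q Q0).
move: Qp; rewrite gtn_max => /andP[Qp Q0p].
exists 'F_p; rewrite card_Fp // ltnW //; split => //.
have [|fam famP le_fam] := famQ 'F_p; first by rewrite card_Fp // ltnW.
exists fam; split => //; apply: le_trans le_fam; rewrite card_Fp //.
by rewrite ler_powR ?ler1n ?prime_gt0 // lerBlDr lerDl ltW.
Qed.
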